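(* Let $\mathcal D=(V,E)$ be a DAG with $V=\{1,\dots,d\}$ and reachability matrix $R$, and let $\mathbf X=(X_1,\dots,X_d)$ be a ML model $X_i=\bigvee_{j=1}^d b_{ji}Z_j$, $i=1,\dots,d$, with ML coefficient matrix $B=(b_{ij})_{d\times d}$ such that $\mathrm{sgn}(B)=R$. Define $$A:=\mathrm{diag}(b_{11},\dots,b_{dd})\quad\text{and}\quad A_0:=\Big(\frac{b_{ij}}{b_{ii}}\mathbf 1_{\mathrm{pa}(j)}(i)\Big)_{d\times d}.$$ Then $\mathbf X$ is a recursive ML model on $\mathcal D$ if and only if the following fixed point equation holds: $$B=A\vee B\odot A_0 .$$ In this case, $$X_i=\bigvee_{k\in\mathrm{pa}(i)}\frac{b_{ki}}{b_{kk}}X_k\vee b_{ii}Z_i,\qquad i=1,\dots,d.$$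
   Context: A ML (max-linear) model is a random vector $\mathbf X$ with $X_i=\bigvee_{j=1}^d b_{ji}Z_j$, $i=1,\dots,d$, where $Z_1,\dots,Z_d$ are independent non-negative random variables, each with support $\mathbb R_+=[0,\infty)$, and $B=(b_{ij})_{d\times d}$ has non-negative entries ($B$ is the ML coefficient matrix). For a DAG $\mathcal D=(V,E)$, $\mathrm{pa}(i)=\{k:(k,i)\in E\}$ denotes the parents of $i$. $\mathbf X$ is a recursive ML model on $\mathcal D$ if there are positive weights $c_{ki}$, $i\in V$, $k\in\mathrm{pa}(i)\cup\{i\}$, such that, with the same noise variables $Z_1,\dots,Z_d$, $X_i=\bigvee_{k\in\mathrm{pa}(i)}c_{ki}X_k\vee c_{ii}Z_i$ for $i=1,\dots,d$ (equalities of random variables are understood almost surely). The reachability matrix $R=(r_{ij})_{d\times d}$ of $\mathcal D$ has $r_{ji}=1$ if there is a directed path from $j$ to $i$ or $j=i$, and $r_{ji}=0$ otherwise. $\mathrm{sgn}(B)$ is the matrix with entry $1$ where $B$ has a positive entry and $0$ elsewhere. $\mathbf 1_U$ is the indicator function of $U$. For non-negative matrices $F=(f_{ij})_{m\times n}$, $G=(g_{ij})_{n\times p}$, $F\odot G:=\big(\bigvee_{k=1}^n f_{ik}g_{kj}\big)_{m\times p}$; for matrices of equal size $\vee$ is the componentwise maximum ($\odot$ binds more strongly than $\vee$). A maximum over the empty set is $0$. *)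

(* Defs.v *)
From HB Require Import structures.
From mathcomp Require Import all_boot all_order all_algebra.
From mathcomp Require Import all_classical all_reals all_analysis.

Set Implicit Arguments.
Unset Strict Implicit.
Unset Printing Implicit Defensive.

Import Order.TTheory GRing.Theory Num.Theory.
Import numFieldNormedType.Exports.

Local Open Scope classical_set_scope.
Local Open Scope ring_scope.

(* E k i is the edge k -> i. [cycle] is about closed directed walks and holds
   vacuously of [::]; loops E x x are excluded through the walk [:: x]. *)
Definition is_dag (V : finType) (E : rel V) : Prop :=
  forall c : seq V, cycle E c -> c = [::].

Section MaxTimes.
Variable R : realType.

(* Entries are meant to be non-negative, so that 0 is neutral for the maximum. *)
Definition maxmul m n p (F : 'M[R]_(m, n)) (G : 'M[R]_(n, p)) : 'M[R]_(m, p) :=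
  \matrix_(i, j) \big[Num.max/0]_(k < n) (F i k * G k j).

Definition maxmx m n (F G : 'M[R]_(m, n)) : 'M[R]_(m, n) := map2_mx Num.max F G.

Definition sgn_mx m n (F : 'M[R]_(m, n)) : 'M[R]_(m, n) :=
  \matrix_(i, j) (0 < F i j)%R%:R.

Variables (d : nat) (E : rel 'I_d).

(* [connect] is the reflexive transitive closure of E. *)
Definition reachability_mx : 'M[R]_d := \matrix_(j, i) (connect E j i)%:R.

Definition A_mx (B : 'M[R]_d) : 'M[R]_d := diag_mx (\row_i B i i).

Definition A0_mx (B : 'M[R]_d) : 'M[R]_d :=
  \matrix_(i, j) (B i j / B i i * (E i j)%:R).

End MaxTimes.

Section Models.
Context (disp : measure_display) (T : measurableType disp) (R : realType).
Context (P : probability T R).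

(* Topological support of the law of Z. *)
Definition rv_support (Z : {RV P >-> R}) : set R :=
  [set x | forall U : set R, open U -> U x -> (0 < distribution P Z U)%E].

Variable d : nat.
Implicit Types (Z X : 'I_d -> {RV P >-> R}).

Definition mutually_independent Z : Prop :=
  forall (J : {set 'I_d}) (S : 'I_d -> set R),
    (forall i, measurable (S i)) ->
    P [set w | forall i, i \in J -> S i (Z i w)] =
    (\prod_(i in J) P (Z i @^-1` S i))%E.

Definition ML_noise Z : Prop :=
  [/\ mutually_independent Z,
      forall i, {ae P, forall w, 0 <= Z i w} &
      forall i, rv_support (Z i) = [set x | 0 <= x]].

Definition ML_model (B : 'M[R]_d) Z X : Prop :=
  [/\ ML_noise Z,
      forall i j, 0 <= B i j &
      forall i, {ae P, forall w,
        X i w = \big[Num.max/0]_(j < d) (B j i * Z j w)}].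

Variable E : rel 'I_d.

(* Only the entries c k i with k a parent of i or k = i are used. *)
Definition recursive_ML_equations (c : 'M[R]_d) Z X : Prop :=
  forall i, {ae P, forall w,
    X i w = Num.max (\big[Num.max/0]_(k < d | E k i) (c k i * X k w))
                    (c i i * Z i w)}.

Definition recursive_ML_model Z X : Prop :=
  exists c : 'M[R]_d,
    (forall k i, E k i || (k == i) -> 0 < c k i) /\
    recursive_ML_equations c Z X.

End Models.

(* Main.v *)
Require Import Defs.
From HB Require Import structures.
From mathcomp Require Import all_boot all_order all_algebra.
From mathcomp Require Import all_classical all_reals all_analysis.

Set Implicit Arguments.
Unset Strict Implicit.
Unset Printing Implicit Defensive.

Import Order.TTheory GRing.Theory Num.Theory.
Import numFieldNormedType.Exports.

Local Open Scope classical_set_scope.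
Local Open Scope ring_scope.

(** Substituting the max-linear representation of X into the recursive
equations with weights c turns their right-hand sides into max-linear functions
of the noise, whose coefficients are the entries of [structural_mx E c B].
Max-linear functions of the noise determine their coefficients: by independence
and because the supports are the whole half-line, one noise variable exceeds 1
while all others are arbitrarily small with positive probability, and on that
event a maximum with a positive coefficient at the large variable is attained
there. Hence the recursive equations hold with weights c iff B satisfies
[B = structural_mx E c B] ([recursive_equationsE]), a purely algebraic
condition on B.

The fixed point equation of the theorem is this condition for one
particular choice of weights, b_ki / b_kk and b_ii ([structural_canonical]).
It remains to pass from arbitrary weights c to these. The fixed point for c
gives b_ii >= c_ii and b_ki >= c_ki b_kk for every edge k -> i, so the canonical
weights dominate c and B <= structural_mx E (canonical_weights B) B. The
converse inequality is the reverse triangle inequality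
b_jk b_ki <= b_ji b_kk ([coef_triangle]): in terms of paths, joining a
heaviest path from j to k with one from k to i produces a path from j to i. It
is proved by induction along the DAG. *)

(** * Directed acyclic graphs *)

Lemma dag_no_return (V : finType) (E : rel V) k i :
  is_dag E -> E k i -> connect E i k = false.
Proof.
move=> dagE Eki; apply/negP => /connectP[p ip kE].
suff /dagE : cycle E (i :: p) by [].
by rewrite /= rcons_path ip -kE.
Qed.

Lemma dag_irrefl (V : finType) (E : rel V) k i :
  is_dag E -> E k i -> (k == i) = false.
Proof.
move=> dagE Eki; apply/eqP => kiE.
by have := dag_no_return dagE Eki; rewrite kiE connect0.
Qed.

(** The number of ancestors strictly increases along the edges. *)
Lemma dag_ind (V : finType) (E : rel V) (Q : V -> Prop) :
  is_dag E -> (forall i, (forall k, E k i -> Q k) -> Q i) -> forall i, Q i.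
Proof.
move=> dagE IH i.
have [n] := ubnP #|[pred l | connect E l i]|.
elim: n i => // n IHn i; rewrite ltnS => lein.
apply: IH => k Eki; apply: IHn; apply: leq_trans lein.
apply/proper_card/properP; split.
  apply/fintype.subsetP => l; rewrite !inE => lk.
  exact: connect_trans lk (connect1 Eki).
by exists i; rewrite !inE ?connect0// dag_no_return.
Qed.

(** * Max-linear algebra *)

Lemma bigmax_ge_idx (R : realType) (I : finType) (Q : pred I) (F : I -> R) :
  0 <= \big[Num.max/0]_(i | Q i) F i.
Proof. by have /bigmax_leP[] := lexx (\big[Num.max/0]_(i | Q i) F i). Qed.

Lemma bigmax_le_nneg (R : realType) (I : finType) (Q : pred I) (F : I -> R) m :
  0 <= m -> (forall i, Q i -> F i <= m) -> \big[Num.max/0]_(i | Q i) F i <= m.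
Proof. by move=> m0 Fm; apply/bigmax_leP. Qed.

Lemma mulr_bigmaxr (R : realType) (I : finType) (Q : pred I) (F : I -> R) c :
  0 <= c ->
  c * \big[Num.max/0]_(i | Q i) F i = \big[Num.max/0]_(i | Q i) (c * F i).
Proof.
move=> c0; elim/big_rec2: _ => [|i x y _ <-]; first by rewrite mulr0.
by rewrite maxr_pMr.
Qed.

Lemma mulr_bigmaxl (R : realType) (I : finType) (Q : pred I) (F : I -> R) c :
  0 <= c ->
  (\big[Num.max/0]_(i | Q i) F i) * c = \big[Num.max/0]_(i | Q i) (F i * c).
Proof.
by move=> c0; rewrite mulrC mulr_bigmaxr//; apply: eq_bigr => i _; rewrite mulrC.
Qed.

Section Structural.
Variables (R : realType) (d : nat) (E : rel 'I_d).
Implicit Types (B c : 'M[R]_d).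

(** Column i holds the coefficients, as a max-linear function of the noise, of
the right-hand side of the i-th recursive equation with weights c when X has
coefficient matrix B. *)
Definition structural_mx c B : 'M[R]_d :=
  \matrix_(j, i) Num.max (\big[Num.max/0]_(k < d | E k i) (c k i * B j k))
                         (c i i * (j == i)%:R).

Definition nneg_weights c := forall k i, E k i || (k == i) -> 0 <= c k i.

Definition canonical_weights B : 'M[R]_d :=
  \matrix_(k, i) (if k == i then B i i else B k i / B k k).

Lemma structural_ge0 c B j i : 0 <= structural_mx c B j i.
Proof. by rewrite mxE le_max bigmax_ge_idx. Qed.

Lemma structural_edge c B j k i : E k i -> c k i * B j k <= structural_mx c B j i.
Proof. by move=> Eki; rewrite mxE le_max le_bigmax_cond. Qed.

Lemma structural_le c B j i m : 0 <= m ->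
  (forall k, E k i -> c k i * B j k <= m) -> (j = i -> c i i <= m) ->
  structural_mx c B j i <= m.
Proof.
move=> m0 Em im; rewrite mxE ge_max bigmax_le_nneg//=.
by case: eqP => [/im|]; rewrite ?mulr1 ?mulr0.
Qed.

Lemma structural_max_linear c B (z x : 'I_d -> R) i :
  nneg_weights c -> (forall j, 0 <= z j) ->
  (forall k, x k = \big[Num.max/0]_(j < d) (B j k * z j)) ->
  Num.max (\big[Num.max/0]_(k < d | E k i) (c k i * x k)) (c i i * z i) =
  \big[Num.max/0]_(j < d) (structural_mx c B j i * z j).
Proof.
move=> c0 z0 xE; have cii : 0 <= c i i by rewrite c0// eqxx orbT.
apply/eqP; rewrite eq_le; apply/andP; split.
  rewrite ge_max; apply/andP; split.
    apply: bigmax_le_nneg => [|k Eki]; first exact: bigmax_ge_idx.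
    rewrite xE mulr_bigmaxr ?c0 ?Eki//; apply: le_bigmax2 => j _.
    by rewrite mulrA ler_wpM2r// structural_edge.
  apply: le_trans (le_bigmax _ _ i); rewrite ler_wpM2r//.
  by rewrite mxE eqxx mulr1 le_max lexx orbT.
have rhs0 : 0 <= Num.max (\big[Num.max/0]_(k < d | E k i) (c k i * x k))
                         (c i i * z i) by rewrite le_max bigmax_ge_idx.
apply: bigmax_le_nneg => // j _.
rewrite mxE maxr_pMl// mulr_bigmaxl// ge_max; apply/andP; split.
  apply: bigmax_le_nneg => // k Eki.
  rewrite le_max; apply/orP; left.
  apply: le_trans (le_bigmax_cond _ _ Eki).
  by rewrite -mulrA ler_wpM2l ?c0 ?Eki// xE le_bigmax.
case: eqP => [->|_]; first by rewrite mulr1 le_max lexx orbT.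
by rewrite mulr0 mul0r.
Qed.

Lemma structural_canonical B : is_dag E -> (forall j i, 0 <= B j i) ->
  structural_mx (canonical_weights B) B = maxmx (A_mx B) (maxmul B (A0_mx E B)).
Proof.
move=> dagE B0; apply/matrixP => j i; rewrite !mxE eqxx maxC; congr Num.max.
  by case: eqP => [->|]; rewrite ?mulr1 ?mulr0.
rewrite bigmax_mkcond; apply: eq_bigr => k _; rewrite !mxE.
case: ifP => [Eki|_]; last by rewrite !mulr0.
by rewrite (dag_irrefl dagE Eki) mulr1 mulrC.
Qed.

(** For k <> i, every path from k to i ends with an edge from some parent l of
i, so the inequality for (j, k, i) follows from those for the (j, k, l). *)
Lemma coef_triangle c B : is_dag E -> nneg_weights c ->
  (forall j i, 0 <= B j i) -> B = structural_mx c B ->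
  forall j k i, B j k * B k i <= B j i * B k k.
Proof.
move=> dagE c0 B0 fixB j k; apply: (dag_ind dagE) => i IH.
have [kiE|nki] := eqVneq k i; first by rewrite kiE.
have [->|Bjk] := eqVneq (B j k) 0; first by rewrite mul0r mulr_ge0.
have {}Bjk : 0 < B j k by rewrite lt_neqAle eq_sym Bjk B0.
(* Isolating b_ki lets its fixed point equation bound it term by term. *)
rewrite mulrC -ler_pdivlMr// {1}fixB; apply: structural_le => [|l Eli|kiE].
- by rewrite divr_ge0// mulr_ge0.
- rewrite ler_pdivlMr// -mulrA (mulrC (B k l)).
  apply: (@le_trans _ _ (c l i * (B j l * B k k))).
    by rewrite ler_wpM2l ?IH// c0// Eli.
  by rewrite mulrA ler_wpM2r// [in leRHS]fixB structural_edge.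
- by rewrite kiE eqxx in nki.
Qed.

Lemma canonical_fixed_point c B : is_dag E -> nneg_weights c ->
  (forall i, 0 < B i i) -> (forall j i, 0 <= B j i) ->
  B = structural_mx c B -> B = structural_mx (canonical_weights B) B.
Proof.
move=> dagE c0 Bii B0 fixB.
have cE i : c i i <= B i i.
  by rewrite [in leRHS]fixB mxE eqxx mulr1 le_max lexx orbT.
apply/matrixP => j i; apply/eqP; rewrite eq_le; apply/andP; split.
  rewrite {1}fixB; apply: structural_le => [|k Eki|jiE].
  - exact: structural_ge0.
  - apply: le_trans (structural_edge _ _ _ Eki).
    rewrite ler_wpM2r// mxE (dag_irrefl dagE Eki) ler_pdivlMr//.
    by rewrite [in leRHS]fixB structural_edge.
  - rewrite mxE jiE eqxx mulr1 mxE eqxx.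
    by rewrite le_max cE orbT.
apply: structural_le => [//|k Eki|->]; last by rewrite mxE eqxx.
rewrite mxE (dag_irrefl dagE Eki) mulrAC ler_pdivrMr// mulrC.
exact: (coef_triangle dagE c0 B0 fixB).
Qed.

End Structural.

(** * Identifiability of the coefficients *)

Section Noise.
Context (disp : measure_display) (T : measurableType disp) (R : realType).
Context (P : probability T R) (d : nat) (Z : 'I_d -> {RV P >-> R}).
Hypothesis noiseZ : ML_noise Z.

(** Each side of the box is an open set meeting the support, so by independence
the noise lies in the box with positive probability. *)
Lemma ae_meets_noise_box (U : 'I_d -> set R) (Q : T -> Prop) :
  (forall i, open (U i)) -> (forall i, exists2 x, 0 <= x & U i x) ->
  {ae P, forall w, Q w} -> exists2 w, (forall i, U i (Z i w)) & Q w.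
Proof.
move=> oU U0 aeQ; case: noiseZ => indep _ suppZ.
have mU i : measurable (U i) by exact: measurable_realfun.open_measurable.
pose A := [set w | forall i, i \in [set: 'I_d]%SET -> U i (Z i w)].
have PA : (0 < P A)%E.
  rewrite indep//; elim/big_ind: _ => [||i _].
  - exact: lte01.
  - by move=> x y; exact: mule_gt0.
  - have [x x0 Ux] := U0 i.
    have : rv_support (Z i) x by rewrite suppZ.
    exact.
have mA : measurable A.
  have -> : A = \bigcap_(i in [set: 'I_d]) (Z i @^-1` U i).
    by apply/seteqP; split => w Aw i => [_|_]; apply: Aw; rewrite ?inE.
  apply: fin_bigcap_measurable => [|i _]; first exact: finite_finset.
  exact: measurable_funPTI.
case: aeQ => N [mN N0 QN]; apply: contrapT => noW.
have AN : A `<=` N.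
  move=> w Aw; apply: QN => Qw; apply: noW; exists w => // i.
  by apply: Aw; rewrite inE.
by move: PA; rewrite (subset_measure0 mA mN AN N0) ltxx.
Qed.

(** If b_j < a_j, take the event where Z_j > 1 and all other noise variables
are below eps, with eps so small that b_l eps < a_j for all l: there the
term a_j Z_j exceeds every term of the other side. *)
Lemma max_linear_coef_le (a b : 'I_d -> R) : (forall j, 0 <= b j) ->
  {ae P, forall w, \big[Num.max/0]_(j < d) (a j * Z j w) <=
                   \big[Num.max/0]_(j < d) (b j * Z j w)} ->
  forall j, a j <= b j.
Proof.
move=> b0 aeab j; rewrite leNgt; apply/negP => bj.
have aj : 0 < a j by exact: le_lt_trans bj.
pose M := \big[Num.max/0]_(l < d) b l.
have M1 : 0 < M + 1 by rewrite ltr_wpDl// bigmax_ge_idx.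
pose eps := a j / (M + 1).
have eps0 : 0 < eps by rewrite divr_gt0.
pose U i := if i == j then [set x : R | 1 < x] else [set x | x < eps].
have oU i : open (U i).
  by rewrite /U; case: ifP => _; [exact: open_gt|exact: open_lt].
have U0 i : exists2 x, 0 <= x & U i x.
  rewrite /U; case: ifP => _; last by exists 0.
  by exists 2 => //=; rewrite ltr1n.
have [w Uw] := ae_meets_noise_box oU U0 aeab.
apply/negP; rewrite -ltNge.
have Zj : 1 < Z j w by have := Uw j; rewrite /U eqxx.
have Zj0 : 0 < Z j w by exact: lt_trans Zj.
apply: lt_le_trans (le_bigmax _ _ j).
apply/bigmax_ltP; split=> [|l _]; first by rewrite mulr_gt0.
have [->|lj] := eqVneq l j; first by rewrite ltr_pM2r.
have Zl : Z l w < eps by have := Uw l; rewrite /U (negbTE lj).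
apply: (@le_lt_trans _ _ (b l * eps)); first by rewrite ler_wpM2l// ltW.
apply: (@lt_trans _ _ (a j)); last by rewrite ltr_pMr.
rewrite mulrA ltr_pdivrMr// mulrC ltr_pM2l//.
by rewrite (@le_lt_trans _ _ M) ?ltrDl// le_bigmax.
Qed.

Lemma max_linear_coef_inj (a b : 'I_d -> R) :
  (forall j, 0 <= a j) -> (forall j, 0 <= b j) ->
  {ae P, forall w, \big[Num.max/0]_(j < d) (a j * Z j w) =
                   \big[Num.max/0]_(j < d) (b j * Z j w)} ->
  forall j, a j = b j.
Proof.
move=> a0 b0 aeab j; apply/eqP; rewrite eq_le.
by rewrite !max_linear_coef_le//; apply: filterS aeab => w ->.
Qed.

Lemma ae_noise_ge0 : {ae P, forall w, forall i, 0 <= Z i w}.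
Proof. by case: noiseZ => _ Z0 _; exact: filter_forall. Qed.

End Noise.

Lemma recursive_equationsE (disp : measure_display) (T : measurableType disp)
    (R : realType) (P : probability T R) (d : nat) (E : rel 'I_d)
    (Z X : 'I_d -> {RV P >-> R}) (B c : 'M[R]_d) :
  ML_model B Z X -> nneg_weights E c ->
  recursive_ML_equations E c Z X <-> B = structural_mx E c B.
Proof.
move=> [noiseZ B0 XE] c0.
have aeX : {ae P, forall w, forall i,
    X i w = \big[Num.max/0]_(j < d) (B j i * Z j w)} by exact: filter_forall.
have aeZ := ae_noise_ge0 noiseZ.
split=> [recX|fixB i].
  apply/matrixP => j i.
  apply: (max_linear_coef_inj noiseZ (a := B^~ i)
    (b := (structural_mx E c B)^~ i)) => // [l|]; first exact: structural_ge0.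
  apply: filterS3 aeX aeZ (recX i) => w Xw Zw.
  by rewrite (structural_max_linear _ c0 Zw Xw) Xw.
apply: filterS2 aeX aeZ => w Xw Zw.
by rewrite (structural_max_linear _ c0 Zw Xw) -fixB.
Qed.

Theorem theorem4p2 (disp : measure_display) (T : measurableType disp)
    (R : realType) (P : probability T R) (d : nat) (E : rel 'I_d)
    (Z X : 'I_d -> {RV P >-> R}) (B : 'M[R]_d)
    (hE : is_dag E) (hX : ML_model B Z X)
    (hB : sgn_mx B = reachability_mx R E) :
  (recursive_ML_model E Z X <-> B = maxmx (A_mx B) (maxmul B (A0_mx E B))) /\
  (recursive_ML_model E Z X ->
   forall i : 'I_d, {ae P, forall w,
     X i w = Num.max
       (\big[Num.max/0]_(k < d | E k i) (B k i / B k k * X k w))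
       (B i i * Z i w)}).
Proof.
have B0 : forall j i, 0 <= B j i by case: hX.
have sgnB j i : (0 < B j i) = connect E j i.
  move/matrixP/(_ j i): hB; rewrite !mxE => /eqP.
  by rewrite eqr_nat; case: (0 < _); case: connect.
have wB0 k i : E k i || (k == i) -> 0 < canonical_weights B k i.
  rewrite mxE; case: eqP => [_ _|_]; first by rewrite sgnB connect0.
  by rewrite orbF => Eki; rewrite divr_gt0 ?sgnB ?connect0// connect1.
have nnegB : nneg_weights E (canonical_weights B) by move=> k i /wB0/ltW.
have fixP : recursive_ML_model E Z X <->
    B = structural_mx E (canonical_weights B) B.
  split=> [[c [c0 recX]]|fixB].
    have nnegc : nneg_weights E c by move=> k i /c0/ltW.
    apply: (canonical_fixed_point hE nnegc _ B0) => [i|]; first by rewrite sgnB connect0.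
    exact/(recursive_equationsE hX nnegc).
  exists (canonical_weights B); split=> //.
  exact/(recursive_equationsE hX nnegB).
split; first by rewrite -structural_canonical.
move=> /fixP/(recursive_equationsE hX nnegB) recX i.
apply: filterS (recX i) => w ->; rewrite mxE eqxx; congr Num.max.
by apply: eq_bigr => k Eki; rewrite mxE (dag_irrefl hE Eki).
Qed.
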